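(* Let $I$ be an instance of Min d-VP with items $a_1,\ldots,a_n$. Suppose that for every dimension $i\in\{1,\ldots,d\}$ the Min BP instance $I_i$ has an equivalent graph $G_i=(V,E_i)$, where $V=\{v_1,\ldots,v_n\}$ and $v_j$ corresponds to item $a_j$. Let $G=(V,E_1\cup\cdots\cup E_d)$. Then $\mathrm{OPT}(I)\ge\omega(G)$.
   Context: Min d-VP: an instance consists of $n$ items $a_1,\ldots,a_n$, a number $d$ of dimensions and $n$ bins. Each item $a_j$ has a size vector $(s_{1,j},\ldots,s_{d,j})$ of positive rationals. A set of items fits into a bin if each component of the sum of their size vectors is at most $1$. The task is to find $n$ pairwise disjoint (possibly empty) subsets of the items, covering all items, such that each subset fits into a bin and the number of non-empty subsets is minimized. $\mathrm{OPT}(I)$ is this minimum. For dimension $i$, $I_i$ is the Min BP instance with items $a_1,\ldots,a_n$ and sizes $s_{i,1},\ldots,s_{i,n}$. A Min BP instance with sizes $s_1,\ldots,s_n$ and a graph $H$ are equivalent if there is a bijection $f$ from the items to the vertices of $H$ such that for every item subset $A'$ the characteristic vector $(x_1,\ldots,x_n)$ of $A'$ satisfies $s_1x_1+\cdots+s_nx_n\le1$ if and only if $f(A')$ is independent in $H$. $\omega(G)$ is the size of a largest clique of $G$. *)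

(* Defs.v *)
From HB Require Import structures.
From mathcomp Require Import all_boot all_order all_algebra.

Set Implicit Arguments.
Unset Strict Implicit.
Unset Printing Implicit Defensive.

Import Order.TTheory GRing.Theory Num.Theory.
Local Open Scope ring_scope.

Record sgraph (V : finType) := SGraph {
  adj : rel V;
  adj_sym : symmetric adj;
  adj_irrefl : irreflexive adj
}.

Definition independent (V : finType) (G : sgraph V) (A : {set V}) : bool :=
  [forall u in A, forall w in A, ~~ adj G u w].

Definition clique (V : finType) (G : sgraph V) (C : {set V}) : bool :=
  [forall u in C, forall w in C, (u != w) ==> adj G u w].

Definition omega (V : finType) (G : sgraph V) : nat :=
  \max_(C : {set V} | clique G C) #|C|.

Section GraphUnion.
Variables (V I : finType) (G : I -> sgraph V).

Definition union_adj : rel V := fun u w => [exists i, adj (G i) u w].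

Fact union_adj_sym : symmetric union_adj.
Proof. by move=> u w; apply: eq_existsb => i; rewrite adj_sym. Qed.

Fact union_adj_irrefl : irreflexive union_adj.
Proof. by move=> u; apply/existsP=> -[i]; rewrite adj_irrefl. Qed.

Definition graph_union : sgraph V := SGraph union_adj_sym union_adj_irrefl.
End GraphUnion.

Record bp_instance (n : nat) := BPInstance {
  bp_size : 'I_n -> rat;
  bp_size_gt0 : forall j, 0 < bp_size j
}.

Record vp_instance (d n : nat) := VPInstance {
  vp_size : 'I_d -> 'I_n -> rat;
  vp_size_gt0 : forall i j, 0 < vp_size i j
}.

Definition vp_component (d n : nat) (I : vp_instance d n) (i : 'I_d) :
  bp_instance n := BPInstance (vp_size_gt0 I i).

Definition char_vec (n : nat) (A : {set 'I_n}) (j : 'I_n) : rat :=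
  (j \in A)%:R.

Definition bp_equiv_via (n : nat) (J : bp_instance n) (V : finType)
    (H : sgraph V) (f : 'I_n -> V) : Prop :=
  bijective f /\
  forall A : {set 'I_n},
    (\sum_(j < n) bp_size J j * char_vec A j <= 1) <->
    independent H [set f j | j in A].

Section MinVP.
Variables (d n : nat) (I : vp_instance d n).

Definition vp_fits (A : {set 'I_n}) : bool :=
  [forall i : 'I_d, \sum_(j in A) vp_size I i j <= 1].

(* [B b] is the set of items put into the [b]-th of the [n] bins. *)
Definition vp_feasible (B : {ffun 'I_n -> {set 'I_n}}) : bool :=
  [&& [forall b, forall c, (b != c) ==> [disjoint B b & B c]],
      \bigcup_b B b == [set: 'I_n]
    & [forall b, vp_fits (B b)]].

Definition vp_cost (B : {ffun 'I_n -> {set 'I_n}}) : nat :=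
  #|[set b | B b != set0]|.

(* An instance has no feasible solution iff some item has a component       *)
(* larger than 1; [vp_opt] is then 0, so that no lower bound on [vp_opt]    *)
(* holds merely because the instance is infeasible.                         *)
Definition vp_opt : nat :=
  if [pick B | vp_feasible B] is Some B0
  then vp_cost [arg min_(B < B0 | vp_feasible B) vp_cost B]%N
  else 0.

End MinVP.

(* Main.v *)
Require Import Defs.
From HB Require Import structures.
From mathcomp Require Import all_boot all_order all_algebra.

(** A set of items that fits into a bin is independent in every [G i], hence
    in the union graph, so a bin holds at most one vertex of a clique.  The
    instance is feasible because singletons are independent in a loopless
    graph, so that every item fits alone into a bin. *)

Lemma sum_char_vec (n : nat) (s : 'I_n -> rat) (A : {set 'I_n}) :
  (\sum_(j < n) s j * char_vec A j = \sum_(j in A) s j)%R.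
Proof.
rewrite [RHS]big_mkcond; apply: eq_bigr => j _.
by rewrite /char_vec; case: (j \in A); rewrite ?GRing.mulr1 ?GRing.mulr0.
Qed.

Lemma independent1 (V : finType) (G : sgraph V) (u : V) :
  independent G [set u].
Proof.
apply/forall_inP => x /set1P ->; apply/forall_inP => y /set1P ->.
by rewrite adj_irrefl.
Qed.

(** An edge of the union inside [A] would already be an edge of some [G i]. *)
Lemma independent_graph_union (V I : finType) (G : I -> sgraph V)
    (A : {set V}) :
  (forall i, independent (G i) A) -> independent (graph_union G) A.
Proof.
move=> indA; apply/forall_inP => u uA; apply/forall_inP => w wA.
apply/existsP => -[i]; apply/negP.
by move/forall_inP: (indA i) => /(_ u uA)/forall_inP/(_ w wA).
Qed.

(** Two distinct common vertices would be both adjacent and non-adjacent. *)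
Lemma clique_independent_eq (V : finType) (G : sgraph V) (C A : {set V})
    (u w : V) :
    clique G C -> independent G A ->
    u \in C -> w \in C -> u \in A -> w \in A ->
  u = w.
Proof.
move=> /forall_inP cC /forall_inP iA uC wC uA wA; apply/eqP/negPn/negP => neq.
move/forall_inP: (cC u uC) => /(_ w wC)/implyP/(_ neq).
by move/forall_inP: (iA u uA) => /(_ w wA)/negP.
Qed.

Section Bound.
Variables (d n : nat) (I : vp_instance d n) (V : finType).
Variables (v : 'I_n -> V) (G : 'I_d -> sgraph V).
Hypothesis bij_v : bijective v.
Hypothesis equivG : forall i, bp_equiv_via (vp_component I i) (G i) v.

Lemma vp_fitsP (A : {set 'I_n}) :
  reflect (forall i, independent (G i) [set v j | j in A]) (vp_fits I A).
Proof.
apply: (iffP forallP) => fitA i; have [_ /(_ A) eqA] := equivG i;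
  have := fitA i; rewrite -(sum_char_vec _ (vp_size I i)) => /eqA //.
Qed.

Lemma vp_feasible_singletons : vp_feasible I [ffun j => [set j]].
Proof.
apply/and3P; split.
- apply/forallP => b; apply/forallP => c; apply/implyP => neq_bc.
  by rewrite !ffunE disjoints1 inE.
- apply/eqP/setP => j; rewrite inE; apply/bigcupP.
  by exists j; rewrite // ffunE set11.
- apply/forallP => b; rewrite ffunE; apply/vp_fitsP => i.
  by rewrite imset_set1 independent1.
Qed.

Lemma clique_le_vp_cost (B : {ffun 'I_n -> {set 'I_n}}) (C : {set V}) :
  vp_feasible I B -> clique (graph_union G) C -> #|C| <= vp_cost B.
Proof.
move=> /and3P[_ /eqP coverB /forallP fitB] cC.
have [g gK vK] := bij_v.
have binP u : exists b, g u \in B b.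
  have : g u \in \bigcup_b B b by rewrite coverB inE.
  by case/bigcupP => b _; exists b.
(* Each vertex [u] is sent to a chosen bin that holds its item [g u]; one exists because the bins
   cover all items. *)
pose bin u := xchoose (binP u).
have mem_bin u : g u \in B (bin u) := xchooseP (binP u).
have mem_v_bin u : u \in [set v j | j in B (bin u)].
  by apply/imsetP; exists (g u); rewrite ?vK.
(* The vertices of one bin form an independent set of the union graph, so clique vertices sharing a
   bin coincide. *)
have inj_bin : {in C &, injective bin}.
  move=> u w uC wC eq_bin.
  have indB : independent (graph_union G) [set v j | j in B (bin u)].
    by apply: independent_graph_union; apply/vp_fitsP/fitB.
  apply: (clique_independent_eq _ _ _ _ _ _ cC indB) => //.
  by rewrite eq_bin.
(* The image of [C] under [bin] has [#|C|] elements, all of them non-empty bins: [bin u] contains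
   [g u]. *)
rewrite -(card_in_imset inj_bin); apply: subset_leq_card; apply/subsetP => b.
by case/imsetP => u _ ->; rewrite inE; apply/set0Pn; exists (g u).
Qed.

End Bound.

Theorem theorem4p33 (d n : nat) (I : vp_instance d n) (V : finType)
    (v : 'I_n -> V) (G : 'I_d -> sgraph V) :
  bijective v ->
  (forall i : 'I_d, bp_equiv_via (vp_component I i) (G i) v) ->
  omega (graph_union G) <= vp_opt I.
Proof.
move=> bij_v equivG; apply/bigmax_leqP => C cC; rewrite /vp_opt.
case: pickP => [B0 feasB0 | /(_ [ffun j => [set j]])].
  case: arg_minnP => // B feasB _.
  exact: (clique_le_vp_cost _ _ _ _ _ _ bij_v equivG).
(* Here [vp_opt] would take its default value 0, which bounds no non-empty clique; the packing with
   one item per bin excludes this case. *)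
by rewrite (vp_feasible_singletons _ _ _ _ _ _ equivG).
Qed.
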